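(* Let $n>m\ge3$, and let $\mathbb{K}$, its $W_{m,n}$-action and the field $\mathcal{L}=\mathbb{K}(f_1,\dots,f_m;\tau_1,\dots,\tau_n)$ be as in the context. Define automorphisms $s_0,\dots,s_{n-1}$ of $\mathcal{L}$ extending the given action on $\mathbb{K}$ by: $s_0(\tau_j)=\tau_jf_j$ ($1\le j\le m$), $s_0(\tau_j)=\tau_j$ ($m+1\le j\le n$), $s_k(\tau_j)=\tau_{s_k(j)}$ ($1\le k\le n-1$, $1\le j\le n$), where $s_k(j)$ is the image of $j$ under the transposition $(k,k+1)$; $s_0(f_i)=1/f_i$; $s_k(f_i)=f_{s_k(i)}$ for $1\le k\le m-1$; $s_k(f_i)=f_i$ for $m+1\le k\le n-1$; $$s_m(f_i)=\frac{\tau_m}{\tau_{m+1}}\cdot\frac{[\alpha_0+\varepsilon_{m,m+1}][\varepsilon_{i,m+1}]f_i-[\alpha_0+\varepsilon_{i,m+1}][\varepsilon_{m,m+1}]f_m}{[\alpha_0][\varepsilon_{i,m}]}\quad(1\le i\le m-1),\qquad s_m(f_m)=\frac{\tau_m}{\tau_{m+1}}f_m.$$ Then $s_0,\dots,s_{n-1}$ satisfy the fundamental relations of the simple reflections of $W_{m,n}$: $s_i^2=1$; $s_is_j=s_js_i$ if nodes $i,j$ are not joined; $s_is_js_i=s_js_is_j$ if nodes $i,j$ are joined in the tree $T_{2,m,n-m}$.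
   Context: $[x]$ is a fixed nonzero odd holomorphic function on $\mathbb{C}$ satisfying the Riemann relation $[x+y][x-y][u+v][u-v]=[x+u][x-u][y+v][y-v]-[x+v][x-v][y+u][y-u]$ for all $x,y,u,v\in\mathbb{C}$. $\mathfrak{h}=\bigoplus_{j=0}^n\mathbb{C}e_j$ with symmetric form $\langle e_0,e_0\rangle=-(m-2)$, $\langle e_j,e_j\rangle=1$ ($1\le j\le n$), $\langle e_i,e_j\rangle=0$ ($i\ne j$); $\varepsilon_j=\langle e_j,\cdot\rangle\in\mathfrak{h}^*$, $\varepsilon_{i,j}=\varepsilon_i-\varepsilon_j$. Simple coroots $h_0=e_0-e_1-\dots-e_m$, $h_k=e_k-e_{k+1}$ ($1\le k\le n-1$); simple roots $\alpha_k=\langle h_k,\cdot\rangle$, so $\alpha_0=\varepsilon_0-\varepsilon_1-\dots-\varepsilon_m$. The tree $T_{2,m,n-m}$ has nodes $0,\dots,n-1$, with $1-2-\dots-(n-1)$ a chain and node $0$ joined to node $m$. $W_{m,n}$ is the Coxeter group on $s_0,\dots,s_{n-1}$ for this tree; it acts on $\mathfrak{h}^*$ by $s_k.\lambda=\lambda-\langle h_k,\lambda\rangle\alpha_k$. Real roots: $\Delta=W_{m,n}\{\alpha_0,\dots,\alpha_{n-1}\}$. For $\alpha\in\mathfrak{h}^*$, $[\alpha]$ denotes the function $h\mapsto[\alpha(h)]$ on $\mathfrak{h}$. $\mathbb{K}$ is the field of meromorphic functions on $\mathfrak{h}$ generated over $\mathbb{C}$ by $[\alpha]$, $\alpha\in\Delta$;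 $W_{m,n}$ acts on $\mathbb{K}$ by field automorphisms with $w([\alpha])=[w.\alpha]$. $\mathcal{L}$ is the field of rational functions in indeterminates $f_1,\dots,f_m,\tau_1,\dots,\tau_n$ over $\mathbb{K}$. *)

(* Defs.v *)
From HB Require Import structures.
From mathcomp Require Import all_boot all_order all_algebra.
From mathcomp Require Import complex.
From mathcomp Require Import all_classical all_reals topology normedtype derive.
Import numFieldNormedType.Exports.

Set Implicit Arguments.
Unset Strict Implicit.
Unset Printing Implicit Defensive.
Import Order.TTheory GRing.Theory Num.Theory.
Local Open Scope ring_scope.
Local Open Scope classical_set_scope.

Definition Cplx (R : realType) : numFieldType := R[i].

Definition entire (R : realType) (th : Cplx R -> Cplx R) : Prop :=
  forall z : Cplx R, derivable th z 1.

Definition riemann_relation (R : realType) (th : Cplx R -> Cplx R) : Prop :=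
  forall x y u v : Cplx R,
    th (x + y) * th (x - y) * th (u + v) * th (u - v)
    = th (x + u) * th (x - u) * th (y + v) * th (y - v)
    - th (x + v) * th (x - v) * th (y + u) * th (y - u).

Definition vat (T : zmodType) (N : nat) (v : 'rV[T]_N) (j : nat) : T :=
  match @insub _ (fun k => k < N)%N ('I_N) j with
  | Some i => v ord0 i
  | None => 0
  end.

Section Model.
Variables (R : realType) (m n : nat).
Local Notation C := (Cplx R).

(* A point of  h x C^m x C^n :  h = sum_{j=0}^n x_j e_j, the values of
   f_1..f_m and of tau_1..tau_n.  Elements of L are (meromorphic) functions
   of such a point. *)
Definition point := ('rV[C]_(n.+1) * 'rV[C]_m * 'rV[C]_n)%type.

Definition hx (p : point) := p.1.1.
(* 1-based accessors f_i, tau_j, and coordinate x_j (0-based, j = 0..n). *)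
Definition fi (p : point) (i : nat) : C := vat p.1.2 i.-1.
Definition taui (p : point) (j : nat) : C := vat p.2 j.-1.

Definition wt (j : nat) : C := if j == 0%N then - (m%:R - 2) else 1.

Definition form (x y : 'rV[C]_(n.+1)) : C :=
  \sum_(j < n.+1) wt j * x ord0 j * y ord0 j.

(* epsilon_j (h) = <e_j, h> *)
Definition eps (j : nat) (x : 'rV[C]_(n.+1)) : C := wt j * vat x j.
Definition eps2 (i j : nat) (x : 'rV[C]_(n.+1)) : C := eps i x - eps j x.
Definition alpha0 (x : 'rV[C]_(n.+1)) : C :=
  eps 0 x - \sum_(1 <= i < m.+1) eps i x.

Definition coroot (k : nat) : 'rV[C]_(n.+1) :=
  \row_(j < n.+1)
    (if k == 0%N then
       (if val j == 0%N then 1 else if (val j <= m)%N then -1 else 0)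
     else if val j == k then 1 else if val j == k.+1 then -1 else 0).

(* The reflection of h dual to s_k:  s_k([alpha]) = [s_k.alpha] = [alpha] o refl k. *)
Definition refl (k : nat) (x : 'rV[C]_(n.+1)) : 'rV[C]_(n.+1) :=
  x - form (coroot k) x *: coroot k.

Definition swp (k j : nat) : nat :=
  if j == k then k.+1 else if j == k.+1 then k else j.

Variable th : C -> C.

Definition sm_f (p : point) (i : nat) : C :=
  let x := hx p in
  if i == m then taui p m / taui p m.+1 * fi p m
  else taui p m / taui p m.+1 *
       ((th (alpha0 x + eps2 m m.+1 x) * th (eps2 i m.+1 x) * fi p i
         - th (alpha0 x + eps2 i m.+1 x) * th (eps2 m m.+1 x) * fi p m)
        / (th (alpha0 x) * th (eps2 i m x))).

(* The point map sigma_k : p |-> (refl_k h, s_k(f_1),...,s_k(f_m), s_k(tau_1),...,s_k(tau_n))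
   evaluated at p.  For any F in L, (s_k F)(p) = F(sigma_k p). *)
Definition sigma (k : nat) (p : point) : point :=
  let x' := refl k (hx p) in
  let f' : 'rV[C]_m := \row_(i < m)
     (let i1 := (val i).+1 in
      if k == 0%N then (fi p i1)^-1
      else if (k < m)%N then fi p (swp k i1)
      else if k == m then sm_f p i1
      else fi p i1) in
  let t' : 'rV[C]_n := \row_(j < n)
     (let j1 := (val j).+1 in
      if k == 0%N then (if (j1 <= m)%N then taui p j1 * fi p j1 else taui p j1)
      else taui p (swp k j1)) in
  (x', f', t').

End Model.

(* Adjacency in the tree T_{2,m,n-m}: chain 1 - 2 - ... - (n-1), and 0 - m. *)
Definition joined (m : nat) (i j : nat) : bool :=
  [|| [&& i != 0%N, j != 0%N & (i.+1 == j) || (j.+1 == i)],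
      (i == 0%N) && (j == m) | (j == 0%N) && (i == m) ].

(* Equality of two maps "generically": on a dense open set.  Two elements of
   the field L (meromorphic in h, rational in f, tau) are equal iff their
   values agree on a dense open set. *)
Definition generically_eq (T : topologicalType) (U : Type) (g1 g2 : T -> U) : Prop :=
  exists O : set T, open O /\ dense O /\ forall p, O p -> g1 p = g2 p.

(* Main.v *)
Require Import Defs.
From HB Require Import structures.
From mathcomp Require Import all_boot all_order all_algebra.
From mathcomp Require Import complex.
From mathcomp Require Import all_classical all_reals topology normedtype derive.
From mathcomp Require Import zify ring.
Set Implicit Arguments.
Unset Strict Implicit.
Unset Printing Implicit Defensive.
Import numFieldNormedType.Exports.
Import Order.TTheory GRing.Theory Num.Theory.
Local Open Scope ring_scope.
Local Open Scope classical_set_scope.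


(** Off the zeros of the theta factors, of the coordinates f_i, tau_j and of the
    numerators of s_m(f_i), every relation is an identity between compositions
    of explicit maps.  On h* these are the relations of a reflection group.  On
    the f_i all of them are rational identities up to the oddness of [.],
    except s_m s_(m+1) s_m = s_(m+1) s_m s_(m+1), which is exactly an instance
    of the Riemann relation.

    The excluded set is nowhere dense because the zeros of [.] are.  This needs
    only continuity: if [.] vanished near a, then

    - the relation at (p,q,r,s) = (t,t,t,c), with p = x+y, q = x-y, r = u+v,
      s = u-v and c small, shows that [.] vanishes near 2a/3, hence near
      a_k = (2/3)^k a for every k;
    - the relation at (c, 0, a_k, P - a_k) gives [P][2 a_k - P] = 0 for every
      P, so k -> oo yields [P][-P] = 0. *)

(** * Zeros of an odd solution of the Riemann relation *)

Section ZeroSet.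
Variables (K : numFieldType) (th : K -> K).
Hypothesis arch : forall x : K, exists N : nat, `|x| < N%:R.
Hypothesis th_open : forall t, th t != 0 ->
  exists2 d : K, 0 < d & forall h, `|h| < d -> th (t + h) != 0.
Hypothesis th_odd : forall z, th (- z) = - th z.
Hypothesis th_riem : forall x y u v : K,
    th (x + y) * th (x - y) * th (u + v) * th (u - v)
    = th (x + u) * th (x - u) * th (y + v) * th (y - v)
    - th (x + v) * th (x - v) * th (y + u) * th (y - u).

Lemma odd_at0 : th 0 = 0.
Proof.
have := th_odd 0; rewrite oppr0 => /eqP; rewrite -addr_eq0 -mulr2n.
by rewrite mulrn_eq0 /= => /eqP.
Qed.

Lemma arch_lt (x d : K) : 0 < d -> exists N : nat, `|x| < N.+1%:R * d.
Proof.
move=> d0; have [N hN] := arch (x / d); exists N.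
rewrite -ltr_pdivrMr //; move: hN; rewrite normrM normfV (gtr0_norm d0) => hN.
by rewrite (lt_trans hN)// ltr_nat.
Qed.

(** Equivalent to [(3/2)^k >= k/2]: each step adds half of the previous power, hence at least 1/2.
    The bound replaces a passage to the limit by an explicit choice of exponent. *)
Lemma two_thirds_pow (k : nat) : k%:R * (2%:R / 3%:R) ^+ k <= 2%:R :> K.
Proof.
suff h : k%:R / 2%:R <= (3%:R / 2%:R) ^+ k :> K.
  have p : 0 <= (2%:R / 3%:R) ^+ k :> K by rewrite exprn_ge0// divr_ge0// ler0n.
  have := ler_wpM2r p h; rewrite -exprMn.
  have -> : 3%:R / 2%:R * (2%:R / 3%:R) = 1 :> K by field.
  by rewrite expr1n mulrAC ler_pdivrMr ?mul1r ?ltr0n.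
elim: k => [|k IH]; first by rewrite mul0r expr0 ler01.
have [->|k1] := posnP k; first by rewrite expr1 ler_pM2r ?invr_gt0 ?ltr0n// ler_nat.
have e1 : 1 <= (3%:R / 2%:R) ^+ k :> K.
  by rewrite exprn_ege1// ler_pdivlMr ?ltr0n// mul1r ler_nat.
rewrite exprS -natr1 mulrDl.
have -> : 3%:R / 2%:R * (3%:R / 2%:R) ^+ k
  = (3%:R / 2%:R) ^+ k + 1 / 2%:R * (3%:R / 2%:R) ^+ k :> K by field.
by apply: lerD => //; rewrite ler_peMr// divr_ge0// ler0n.
Qed.

(* If [th] vanished on the ball of radius [r] at 0, non-vanishing at [t] would
   propagate along the progression of step [t / N] down to 0. *)
Lemma nonzero_near0 (t r : K) : th t != 0 -> 0 < r ->
  exists2 c, `|c| < r & th c != 0.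
Proof.
move=> tn0 r0; apply/not_exists2P => hz.
have z c : `|c| < r -> th c = 0.
  by move=> cr; have [//|/negP] := hz c; rewrite negbK => /eqP.
have step s e : `|e| < r -> th s != 0 -> th (s + 2%:R * e) != 0 ->
    th (s - e) != 0 /\ th (s + e) != 0.
  move=> er s0 s2.
  (* The first product on the right contains [th (- e) = 0]. Up to sign, [th s ^ 3] times
     [th (s + 2 e)] is then a product with factors [th (s - e)] and [th (s + e)]. *)
  have := th_riem s 0 (s + e) (- e).
  rewrite add0r (z (- e)) ?normrN//.
  rewrite (_ : s + e + - e = s) ?addrK// (_ : s + e - - e = s + 2%:R * e); last by ring.
  rewrite addr0 subr0 opprK !(mulr0, mul0r) !sub0r add0r => h.
  have : th s * th s * th s * th (s + 2%:R * e) != 0 by rewrite !mulf_neq0.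
  by rewrite h oppr_eq0 !mulf_eq0 !negb_or => /andP[/andP[/andP[-> ->]]].
have [d d0 hd] := th_open tn0.
(* This bound for [|e|] is below both [r] and [d / 2], whatever the relative size of [d] and [r]. *)
have m0 : 0 < d * r / (2%:R * (d + r)).
  by rewrite divr_gt0 ?mulr_gt0 ?addr_gt0 ?ltr0n.
have [N] := arch_lt t m0; set e := t / N.+1%:R.
rewrite mulrC -ltr_pdivrMr ?ltr0n// -[X in _ / X]ger0_norm ?ler0n// -normf_div -/e.
move=> eN.
have er : `|e| < r.
  apply: lt_le_trans eN _; rewrite ler_pdivrMr ?mulr_gt0 ?addr_gt0 ?ltr0n//.
  by rewrite mulrC ler_pM2l// mulr_natl mulr2n -addrA lerDl !addr_ge0 ?ltW.
have ed : `|2%:R * e| < d.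
  rewrite normrM ger0_norm ?ler0n// mulrC -ltr_pdivlMr ?ltr0n//.
  apply: lt_le_trans eN _.
  rewrite ler_pdivrMr ?mulr_gt0 ?addr_gt0 ?ltr0n// mulrA mulfVK ?pnatr_eq0//.
  by rewrite ler_pM2l// lerDr ltW.
(* [step] consumes this pair of conditions at [t - k e] and reproduces it at [t - (k + 1) e]. For
   [k = N + 1] the first point is 0, a zero of [th]. *)
suff P k : th (t - k%:R * e) != 0 /\ th (t - k%:R * e + 2%:R * e) != 0.
  have [+ _] := P N.+1.
  by rewrite /e mulrC divfK ?pnatr_eq0// subrr odd_at0 eqxx.
elim: k => [|k [IH1 IH2]]; first by rewrite mul0r subr0; split=> //; exact: hd.
have [h1 h2] := step _ _ er IH1 IH2; rewrite -natr1.
by split; [move: h1|move: h2]; congr (th _ != 0); ring.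
Qed.

(** At a nonzero [t] near [2a/3] the left side of the relation is [th t ^ 3] times [th c]. Each
    product on the right has a factor [th (t + (t + c) / 2)] or [th (t + (t - c) / 2)], and
    multiplying [2a/3] by 3/2 brings these arguments back near [a]. *)
Lemma zero_ball_scale (a r : K) : 0 < r -> (forall h, `|h| < r -> th (a + h) = 0) ->
  forall h, `|h| < 2%:R / 3%:R * r -> th (2%:R / 3%:R * a + h) = 0.
Proof.
move=> r0 z h hr; apply/eqP/contraT; set t := _ + h => tn0.
have g0 : 0 < 2%:R / 3%:R * r - `|h| by rewrite subr_gt0.
(* From [|c| < 2r/3 - |h|] and [|h| < 2r/3] one gets [3|h| + |c| < 2r], which is what keeps both
   arguments in the ball around [a]. *)
have [c cr cn0] := nonzero_near0 tn0 g0.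
have := th_riem t 0 ((t + c) / 2%:R) ((t - c) / 2%:R).
rewrite addr0 subr0.
have -> : (t + c) / 2%:R + (t - c) / 2%:R = t by field.
have -> : (t + c) / 2%:R - (t - c) / 2%:R = c by field.
have b e : `|e| <= `|c| -> th (t + (t + e) / 2%:R) = 0.
  move=> ec.
  have -> : t + (t + e) / 2%:R = a + (3%:R * h + e) / 2%:R by rewrite /t; field.
  apply: z; rewrite normf_div (ger0_norm (ler0n _ 2)) ltr_pdivrMr ?ltr0n//.
  apply: le_lt_trans (ler_normD _ _) _; rewrite normrM (ger0_norm (ler0n _ 3)).
  have {}ec : `|e| < 2%:R / 3%:R * r - `|h| by exact: le_lt_trans cr.
  rewrite ltrBrDr in ec; have := ltrD ec (ltrD hr hr).
  by congr (_ < _); field.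
rewrite (b c)// (b (- c)) ?normrN// !mul0r subr0 => /eqP.
by rewrite !mulf_eq0 (negbTE tn0) (negbTE cn0).
Qed.

Lemma zero_nowhere_dense (t a r : K) : th t != 0 -> 0 < r ->
  exists2 h, `|h| < r & th (a + h) != 0.
Proof.
move=> tn0 r0; apply/not_exists2P => hz.
have z0 h : `|h| < r -> th (a + h) = 0.
  by move=> cr; have [//|/negP] := hz h; rewrite negbK => /eqP.
pose q : K := 2%:R / 3%:R; have q0 : 0 < q by rewrite divr_gt0 ?ltr0n.
have z k h : `|h| < q ^+ k * r -> th (q ^+ k * a + h) = 0.
  elim: k h => [|k IH] h; first by rewrite expr0 !mul1r; apply: z0.
  rewrite !exprS -!(mulrA q); move: h; apply: (zero_ball_scale _ IH).
  by rewrite mulr_gt0 ?exprn_gt0.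
have refl k P : th P * th (2%:R * (q ^+ k * a) - P) = 0.
  have qr : 0 < q ^+ k * r by rewrite mulr_gt0 ?exprn_gt0.
  have [c cr cn0] := nonzero_near0 tn0 qr.
  have := th_riem c 0 (q ^+ k * a) (P - q ^+ k * a).
  have zA : th (q ^+ k * a) = 0 by rewrite -[X in th X]addr0 z ?normr0.
  rewrite addr0 subr0 !add0r zA (addrC c) (z _ _ cr) (addrC _ (P - _)) subrK.
  have -> : q ^+ k * a - (P - q ^+ k * a) = 2%:R * (q ^+ k * a) - P by ring.
  rewrite !(mulr0, mul0r) subr0 -mulrA => /eqP.
  by rewrite mulf_eq0 (negbTE (mulf_neq0 cn0 cn0)) => /eqP.
have [d d0 hd] : exists2 d, 0 < d & forall h, `|h| < d -> th (- t + h) != 0.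
  by apply: th_open; rewrite th_odd oppr_eq0.
(* Since [(N + 1) q^(N + 1) <= 2], the shift [2 q^(N + 1) a] times [N + 1] has norm at most [4|a|];
   so the shift is smaller than [d] and [th] cannot vanish at [2 q^(N + 1) a - t]. *)
have [N hN] := arch_lt (4%:R * a) d0.
have := refl N.+1 t; rewrite addrC => /eqP; rewrite mulf_eq0 (negbTE tn0)/=.
apply/negP/hd; rewrite -(ltr_pM2l (ltr0Sn K N)).
apply: le_lt_trans hN.
have q1 := ger0_norm (exprn_ge0 N.+1 (ltW q0)).
have := two_thirds_pow N.+1; rewrite -/q => h.
rewrite !normrM q1 (ger0_norm (ler0n _ 2)) (ger0_norm (ler0n _ 4)).
have := ler_wpM2l (ler0n _ 2) (ler_wpM2r (normr_ge0 a) h).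
by congr (_ <= _); ring.
Qed.
End ZeroSet.

(** * Open dense sets in a normed space *)

Section Generic.
Variables (K : numFieldType) (V : normedModType K).

Lemma line_continuous (p v : V) : continuous (fun s : K => p + s *: v).
Proof.
move=> s; have h1 : (cst p : K -> V) @ s --> p by apply: cst_continuous.
have h2 : (fun s : K => s *: v) @ s --> s *: v by exact: scalel_continuous.
exact: (cvgD h1 h2).
Qed.

Definition open_dense (S : set V) := open S /\ dense S.

Lemma open_denseI (P Q : set V) :
  open_dense P -> open_dense Q -> open_dense (P `&` Q).
Proof. by move=> [oP dP] [oQ dQ]; split; [exact: openI|exact: denseI]. Qed.

Lemma open_dense_all (I : finType) (P : I -> set V) :
  (forall i, open_dense (P i)) -> open_dense [set p | forall i, P i p].
Proof.
move=> h.
suff H (s : seq I) : open_dense [set p | forall i, i \in s -> P i p].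
  have := H (enum I); congr open_dense.
  apply/seteqP; split=> p /= hp i; last by move=> _; apply: hp.
  by apply: hp; rewrite mem_enum.
elim: s => [|i s IH].
  rewrite (_ : mkset _ = setT); last by apply/seteqP; split.
  by split=> [|O O0 _]; [exact: openT|rewrite setIT].
rewrite (_ : mkset _ = P i `&` [set p | forall j, j \in s -> P j p]).
  exact: open_denseI.
apply/seteqP; split=> p /= => [hp|[h1 h2] j].
  by split=> [|j js]; apply: hp; rewrite inE ?eqxx ?js ?orbT.
by rewrite inE => /orP[/eqP->//|]; apply: h2.
Qed.

(** A nonempty open set meets [D]. If [g] vanishes at the point found there, a small move along a
    single line leaves the zero set without leaving the open set, so density reduces to one complex
    variable. *)
Lemma open_dense_neq0 (g : V -> K) (D : set V) : continuous g -> open_dense D ->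
  (forall p, D p -> g p = 0 -> exists v, forall r : K, 0 < r ->
     exists2 s, `|s| < r & g (p + s *: v) != 0) ->
  open_dense [set p | g p != 0].
Proof.
move=> cg [oD dD] h; split.
  rewrite [X in open X](_ : _ = g @^-1` (~` [set 0])).
    apply: open_comp => [p _|]; first exact: cg.
    exact/closed_openC/accessible_closed_set1/hausdorff_accessible/norm_hausdorff.
  by apply/seteqP; split=> p /= /eqP.
move=> O O0 oO; have [p [Op Dp]] := dD O O0 oO.
have [gp|gp] := eqVneq (g p) 0; last by exists p.
have [v hv] := h p Dp gp.
have : nbhs (0 : K) ((fun s : K => p + s *: v) @^-1` O).
  by apply: line_continuous; rewrite scale0r addr0; exact: open_nbhs_nbhs.
move=> /nbhs_ballP[r r0 hr].
have [s sr gs] := hv r r0; exists (p + s *: v); split => //.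
by apply: hr; rewrite -ball_normE /= sub0r normrN.
Qed.
End Generic.

(** * Identities for the formula defining s_m(f_i) *)

Section Scalar.
Variables (K : fieldType) (th : K -> K).
Hypothesis th_odd : forall z, th (- z) = - th z.

(** The image s_m(f_i) for i < m, with [a] = alpha_0, [u], [v], [w] = eps_m, eps_(m+1), eps_i, [t],
    [t'] = tau_m, tau_(m+1) and [f], [g] = f_i, f_m. With free arguments, compositions of the s_k
    become substitutions. *)
Definition smF (a u v w t t' f g : K) : K :=
  t / t' * ((th (a + (u - v)) * th (w - v) * f
             - th (a + (w - v)) * th (u - v) * g) / (th a * th (w - u))).

Lemma thB x y : th (y - x) = - th (x - y).
Proof. by rewrite -th_odd opprB. Qed.

Lemma smF_invol a u v w t t' f g :
    t != 0 -> t' != 0 -> th a != 0 -> th (a + (u - v)) != 0 ->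
    th (w - u) != 0 -> th (w - v) != 0 ->
  smF (a + (u - v)) v u w t' t (smF a u v w t t' f g) (t / t' * g) = f.
Proof.
move=> t0 t'0 a0 a1 wu wv; rewrite /smF.
have -> : a + (u - v) + (v - u) = a by ring.
have -> : a + (u - v) + (w - u) = a + (w - v) by ring.
rewrite (thB u v).
by field; rewrite ?oppr_eq0 a0 a1 wu wv t0 t'0.
Qed.

(** Exchanging [(u, g)] with [(w, f)] changes the sign of the numerator and of [th (w - u)], so only
    the tau prefactor and [th a] tell nothing apart: the quotient is symmetric up to that
    prefactor. *)
Lemma smF_swap a u v w t t' f g s :
    t != 0 -> th a != 0 -> th (w - u) != 0 ->
  s / t * smF a u v w t t' f g = smF a w v u s t' g f.
Proof.
move=> t0 a0 wu; rewrite /smF (thB w u).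
(* For [t' = 0] the convention [0^-1 = 0] makes both sides vanish. *)
have [->|t'0] := eqVneq t' 0; first by rewrite invr0 !(mulr0, mul0r).
by field; rewrite ?oppr_eq0 a0 wu t0 t'0.
Qed.

(** The two multiples of [g] cancel and [th (a + (u - v))] divides out. *)
Lemma smF_chain a u v y w s t t' f g h :
    t != 0 -> th a != 0 -> th (a + (u - v)) != 0 ->
    th (w - u) != 0 -> th (y - u) != 0 -> th (w - y) != 0 ->
  smF (a + (u - v)) y u w s t (smF a u v w t t' f g) (smF a u v y t t' h g)
  = smF a y v w s t' f h.
Proof.
move=> t0 a0 a1 wu yu wy; rewrite /smF.
have -> : a + (u - v) + (y - u) = a + (y - v) by ring.
have -> : a + (u - v) + (w - u) = a + (w - v) by ring.
have [->|t'0] := eqVneq t' 0; first by rewrite invr0 !(mulr0, mul0r, subrr).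
by field; rewrite ?oppr_eq0 a0 a1 wu yu wy t0 t'0.
Qed.

(** Here [w] has become [v]. By oddness the multiples of [g] cancel again, and the remaining
    coefficient of [h] is the denominator itself. *)
Lemma smF_chain_last a u v y s t t' g h :
    t != 0 -> th a != 0 -> th (a + (u - v)) != 0 ->
    th (y - u) != 0 -> th (y - v) != 0 ->
  smF (a + (u - v)) y u v s t (t / t' * g) (smF a u v y t t' h g) = s / t' * h.
Proof.
move=> t0 a0 a1 yu yv; rewrite /smF.
have -> : a + (u - v) + (y - u) = a + (y - v) by ring.
have -> : a + (u - v) + (v - u) = a by ring.
rewrite (thB y v) (thB u v).
have [->|t'0] := eqVneq t' 0; first by rewrite invr0 !(mulr0, mul0r, subrr).
by field; rewrite ?oppr_eq0 a0 a1 yu yv t0 t'0.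
Qed.

(** The left side is f_i times s_0 s_m(f_i): s_0 negates alpha_0, adds alpha_0 to eps_i and eps_m,
    multiplies tau_m by f_m and inverts f_i and f_m. After clearing the inverses, the two terms of
    the numerator have traded places, and [th (- a)] absorbs the sign. *)
Lemma smF_inv a u v w t t' f g : g != 0 -> f != 0 -> th a != 0 -> th (w - u) != 0 ->
  f * smF (- a) (u + a) v (w + a) (t * g) t' f^-1 g^-1 = smF a u v w t t' f g.
Proof.
move=> g0 f0 a0 wu; rewrite /smF th_odd.
have -> : - a + (u + a - v) = u - v by ring.
have -> : - a + (w + a - v) = w - v by ring.
have -> : w + a - (u + a) = w - u by ring.
have -> : u + a - v = a + (u - v) by ring.
have -> : w + a - v = a + (w - v) by ring.
have [->|t'0] := eqVneq t' 0; first by rewrite invr0 !(mulr0, mul0r).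
by field; rewrite ?oppr_eq0 a0 wu g0 f0 t'0.
Qed.

(** This is [smF_inv] at the values transformed by s_m, followed by the involution s_m. *)
Lemma smF_inv_inv a u v w t t' f g (b := a + (u - v)) (f1 := smF a u v w t t' f g) :
    t != 0 -> t' != 0 -> g != 0 -> f1 != 0 -> th a != 0 -> th b != 0 ->
    th (w - u) != 0 -> th (w - v) != 0 ->
  smF (- b) (v + b) u (w + b) (t' * (t / t' * g)) t f1^-1 (t / t' * g)^-1 = f / f1.
Proof.
move=> t0 t'0 g0 f10 a0 b0 wu wv.
have g10 : t / t' * g != 0 by rewrite !mulf_neq0 ?invr_eq0.
apply: (mulfI f10); rewrite smF_inv// mulrCA divff// mulr1.
exact: smF_invol.
Qed.

Hypothesis th_riem : forall x y u v : K,
    th (x + y) * th (x - y) * th (u + v) * th (u - v)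
    = th (x + u) * th (x - u) * th (y + v) * th (y - v)
    - th (x + v) * th (x - v) * th (y + u) * th (y - u).
Hypothesis two_neq0 : 2%:R != 0 :> K.

(** The coefficients of [f] agree after cancellation; equality of the coefficients of [g] is the
    Riemann relation. *)
Lemma smF_riemann a u v z w t t' t'' f g :
    t' != 0 -> th a != 0 -> th (a + (u - v)) != 0 ->
    th (w - u) != 0 -> th (w - v) != 0 ->
  smF (a + (u - v)) v z w t' t'' (smF a u v w t t' f g) (t / t' * g)
  = smF a u z w t t'' f g.
Proof.
move=> t'0 a0 a1 wu wv; rewrite /smF.
have -> : a + (u - v) + (v - z) = a + (u - z) by ring.
(* These four arguments are half sums and half differences, obtained by prescribing the left
   factors: [a + (w - z)], [a + (u - v)], [u - z] and [w - v]. *)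
have := th_riem (a + (w + u - z - v) / 2%:R) ((w - z - u + v) / 2%:R)
  ((u - z + w - v) / 2%:R) ((u - z - w + v) / 2%:R).
set x := a + _; set y := _ / 2%:R; set p := (u - z + w - v) / _; set q := _ / 2%:R.
have -> : x + y = a + (w - z) by rewrite /x /y; field.
have -> : x - y = a + (u - v) by rewrite /x /y; field.
have -> : p + q = u - z by rewrite /p /q; field.
have -> : p - q = w - v by rewrite /p /q; field.
have -> : x + p = a + (u - v) + (w - z) by rewrite /x /p; field.
have -> : x - p = a by rewrite /x /p; field.
have -> : y + q = v - z by rewrite /y /q; field.
have -> : y - q = w - u by rewrite /y /q; field.
have -> : x + q = a + (u - z) by rewrite /x /q; field.
have -> : x - q = a + (w - v) by rewrite /x /q; field.
have -> : y + p = w - z by rewrite /y /p; field.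
have -> : y - p = v - u by rewrite /y /p; field.
rewrite (thB u v) => riem.
have [->|t''0] := eqVneq t'' 0; first by rewrite invr0 !(mulr0, mul0r).
(* The relation is solved for the coefficient of [g] on the right side; what remains is a rational
   identity. *)
have E : th (a + (w - z)) * th (u - z) = 
  (th (a + (u - v) + (w - z)) * th a * th (v - z) * th (w - u) -
   th (a + (u - z)) * th (a + (w - v)) * th (w - z) * - th (u - v))
  / (th (a + (u - v)) * th (w - v)).
  by rewrite -riem; field; rewrite a1 wv.
rewrite E.
by field; rewrite ?oppr_eq0 a0 a1 wu wv t'0 t''0.
Qed.
End Scalar.

(** * Coordinates of row vectors and transpositions of indices *)

Section Accessors.
Variables (T : zmodType) (N : nat).

Lemma vat_ord (v : 'rV[T]_N) (i : 'I_N) : vat v i = v ord0 i.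
Proof. by rewrite /vat valK. Qed.

Lemma vat_row (F : nat -> T) j : (j < N)%N -> vat (\row_(i < N) F i) j = F j.
Proof. by move=> jN; rewrite -[j]/(val (Ordinal jN)) vat_ord mxE. Qed.

Lemma vat_out (v : 'rV[T]_N) j : (N <= j)%N -> vat v j = 0.
Proof. by move=> Nj; rewrite /vat insubN// -leqNgt. Qed.

Lemma vat_inj (v w : 'rV[T]_N) : (forall j, (j < N)%N -> vat v j = vat w j) -> v = w.
Proof. by move=> h; apply/rowP => i; rewrite -!vat_ord h. Qed.
End Accessors.

Lemma vatD (T : zmodType) N (v w : 'rV[T]_N) j : vat (v + w) j = vat v j + vat w j.
Proof. by rewrite /vat; case: insubP => [i _ _|_]; rewrite ?mxE ?addr0. Qed.

Lemma vatN (T : zmodType) N (v : 'rV[T]_N) j : vat (- v) j = - vat v j.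
Proof. by rewrite /vat; case: insubP => [i _ _|_]; rewrite ?mxE ?oppr0. Qed.

Lemma vatZ (T : pzRingType) N c (v : 'rV[T]_N) j : vat (c *: v) j = c * vat v j.
Proof. by rewrite /vat; case: insubP => [i _ _|_]; rewrite ?mxE ?mulr0. Qed.

Lemma swpK k : involutive (swp k).
Proof. by move=> j; rewrite /swp; repeat case: eqP => //; lia. Qed.

Lemma swp_comm k l j : (k.+1 < l)%N -> swp k (swp l j) = swp l (swp k j).
Proof. by move=> kl; rewrite /swp; repeat case: eqP => //; lia. Qed.

Lemma swp_braid k j : swp k (swp k.+1 (swp k j)) = swp k.+1 (swp k (swp k.+1 j)).
Proof. by rewrite /swp; repeat case: eqP => //; lia. Qed.

Lemma swpL k : swp k k = k.+1.
Proof. by rewrite /swp eqxx. Qed.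

Lemma swpR k : swp k k.+1 = k.
Proof. by rewrite /swp eqxx (gtn_eqF (ltnSn k)). Qed.

Lemma swpD k j : j != k -> j != k.+1 -> swp k j = j.
Proof. by rewrite /swp => /negbTE-> /negbTE->. Qed.

Lemma swp_gt0 k j : (0 < k)%N -> (0 < swp k j)%N = (0 < j)%N.
Proof. by move=> k0; rewrite /swp; repeat case: eqP => ?; lia. Qed.

Lemma swp_le k j N : (k < N)%N -> (swp k j <= N)%N = (j <= N)%N.
Proof. by move=> kN; rewrite /swp; repeat case: eqP => ?; lia. Qed.

Lemma sum_swp (V : zmodType) (F : nat -> V) k m : (0 < k)%N -> (k < m)%N ->
  \sum_(1 <= i < m.+1) F (swp k i) = \sum_(1 <= i < m.+1) F i.
Proof.
move=> k0 km; rewrite -(big_map (swp k) xpredT F); apply: perm_big.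
apply: uniq_perm => [||j].
- by rewrite map_inj_uniq ?iota_uniq//; apply: inv_inj; apply: swpK.
- exact: iota_uniq.
- rewrite -{1}(swpK k j) mem_map; last by apply: inv_inj; apply: swpK.
  rewrite !mem_index_iota /swp; repeat case: eqP => ?; lia.
Qed.

(** * The simple reflections on h and on the forms eps_j *)

Section Relations.
Variables (R : realType) (th : Cplx R -> Cplx R) (m n : nat).
Hypotheses (m_ge3 : (3 <= m)%N) (mn : (m < n)%N).
Local Notation C := (Cplx R).
Implicit Types x : 'rV[C]_(n.+1).
Local Notation form := (@Defs.form R m n).
Local Notation eps := (@eps R m n).
Local Notation refl := (@refl R m n).
Local Notation alpha0 := (@alpha0 R m n).

Definition cf (k j : nat) : C :=
  if k == 0%N then (if j == 0%N then 1 else if (j <= m)%N then -1 else 0)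
  else if j == k then 1 else if j == k.+1 then -1 else 0.

Lemma form_corootE k x : form (coroot R m n k) x = \sum_(0 <= j < n.+1) cf k j * eps j x.
Proof.
rewrite big_mkord; apply: eq_bigr => j _.
by rewrite mxE /Defs.eps vat_ord mulrCA mulrA.
Qed.

Lemma form_coroot0 x : form (coroot R m n 0) x = alpha0 x.
Proof.
rewrite form_corootE /Defs.alpha0 big_ltn// mul1r; congr (_ + _).
rewrite (@big_cat_nat _ _ _ m.+1)//=; last by rewrite ltnW.
rewrite -sumrN [X in _ + X]big1_seq ?addr0.
  by apply: eq_big_nat => i /andP[i0 im]; rewrite /cf eqxx gtn_eqF// -ltnS im mulN1r.
move=> i; rewrite mem_index_iota /cf => /andP[_ /andP[mi _]].
by rewrite eqxx gtn_eqF ?(leq_trans _ mi)// leqNgt mi mul0r.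
Qed.

Lemma form_corootS k x : (0 < k)%N -> (k < n)%N ->
  form (coroot R m n k) x = eps2 m k k.+1 x.
Proof.
move=> k0 kn; rewrite form_corootE /eps2.
have kn1 : (k <= n.+1)%N by lia.
have kn2 : (k < n.+1)%N by lia.
rewrite (@big_cat_nat _ _ _ k)//=.
rewrite big1_seq; last first.
  move=> i; rewrite mem_index_iota /cf => /andP[_ ik].
  by rewrite !ifF ?mul0r//; apply/eqP; lia.
rewrite add0r (big_ltn kn2) (big_ltn (kn : k.+1 < n.+1)%N) big1_seq; last first.
  move=> i; rewrite mem_index_iota /cf => /andP[_ ik].
  by rewrite !ifF ?mul0r//; apply/eqP; lia.
by rewrite /cf (gtn_eqF k0) !eqxx (gtn_eqF (ltnSn k)) mul1r mulN1r addr0.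
Qed.

Lemma eps_refl k x j : eps j (refl k x) =
  eps j x - form (coroot R m n k) x * (if (j <= n)%N then wt R m j * cf k j else 0).
Proof.
rewrite /Defs.eps /Defs.refl vatD vatN vatZ mulrDr mulrN; congr (_ - _).
case: leqP => jn; last by rewrite vat_out// !mulr0.
by rewrite mulrCA; congr (_ * (_ * _)); rewrite /coroot (vat_row (cf k)).
Qed.

(** As [m >= 3], the weight [-(m - 2)] is nonzero: the form is nondegenerate, and the eps_j are
    coordinates on h. *)
Lemma wt_neq0 j : wt R m j != 0.
Proof.
rewrite /wt; case: (j == 0%N); last exact: oner_neq0.
by rewrite oppr_eq0 -(natrB _ (ltnW m_ge3)) pnatr_eq0 -lt0n subn_gt0.
Qed.

Lemma eps_inj x y : (forall j, eps j x = eps j y) -> x = y.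
Proof.
move=> h; apply: vat_inj => j jn.
exact: (mulfI (wt_neq0 j) (h j)).
Qed.

Lemma eps_reflS k x j : (0 < k)%N -> (k < n)%N -> eps j (refl k x) = eps (swp k j) x.
Proof.
move=> k0 kn; rewrite eps_refl form_corootS// /eps2 /swp /cf /wt (gtn_eqF k0).
case: (eqVneq j k) => [->|jk].
  by rewrite (ltnW kn) (gtn_eqF k0) !mulr1 opprB addrC subrK.
case: (eqVneq j k.+1) => [->|jk1].
  by rewrite kn /= mul1r mulrN1 opprK addrC subrK.
by rewrite !mulr0 if_same mulr0 subr0.
Qed.

Lemma eps_refl0 x j : eps j (refl 0 x) =
  eps j x + (if j == 0%N then m%:R - 2 else if (j <= m)%N then 1 else 0) * alpha0 x.
Proof.
rewrite eps_refl form_coroot0 /cf /wt; congr (_ + _).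
case: (posnP j) => [->|j0]; first by rewrite /= mulr1 mulrN opprK mulrC.
rewrite eqxx; case: (leqP j m) => jm.
  by rewrite (ltnW (leq_ltn_trans jm mn)) !mul1r mulrN1 opprK.
by rewrite mulr0 if_same mulr0 oppr0 mul0r.
Qed.

(** The added terms sum to [(m - 2) - m = -2] times alpha_0. *)
Lemma alpha0_refl0 x : alpha0 (refl 0 x) = - alpha0 x.
Proof.
rewrite {1}/Defs.alpha0 eps_refl0 /=.
under eq_big_nat => i /andP[i0 im] do
  rewrite eps_refl0 (gtn_eqF i0) -ltnS im mul1r.
rewrite big_split /= sumr_const_nat subn1 /= {2}/Defs.alpha0 -mulr_natl.
set S := \sum_(_ <= _ < _) _; rewrite /Defs.alpha0 -/S; ring.
Qed.

Lemma alpha0_reflS k x : (0 < k)%N -> (k < n)%N -> k != m ->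
  alpha0 (refl k x) = alpha0 x.
Proof.
move=> k0 kn km; rewrite /Defs.alpha0 eps_reflS//.
rewrite (_ : swp k 0 = 0%N); last by rewrite /swp !ltn_eqF.
congr (_ - _); case: (ltnP k m) => kltm.
  by under eq_bigr do rewrite eps_reflS//; rewrite (sum_swp (fun i => eps i x)).
apply: eq_big_nat => i /andP[i0 im]; rewrite eps_reflS// /swp.
by rewrite !ltn_eqF//; lia.
Qed.

(** Among the transpositions only that of m and m+1 moves an index out of 1, ..., m; it replaces
    eps_m by eps_(m+1) in alpha_0. This is the edge joining nodes 0 and m. *)
Lemma alpha0_reflm x : alpha0 (refl m x) = alpha0 x + (eps m x - eps m.+1 x).
Proof.
have m0 : (0 < m)%N by lia.
rewrite /Defs.alpha0 eps_reflS// (_ : swp m 0 = 0%N); last by rewrite /swp !ltn_eqF.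
rewrite !big_nat_recr//= eps_reflS// /swp eqxx.
under eq_big_nat => i /andP[i0 im] do rewrite eps_reflS// /swp !ltn_eqF ?leqW//.
by rewrite !opprD; ring.
Qed.

(** * The maps sigma_k in coordinates *)

Hypothesis th_odd : forall z, th (- z) = - th z.
Local Notation point := (Defs.point R m n).

(* Locking keeps unification from unfolding compositions of these maps. *)
Definition act := locked (@sigma R m n th).
Local Notation s := act.
Local Notation al p := (alpha0 (hx p)).
Local Notation ep p j := (eps j (hx p)).
Implicit Types p q : point.

Lemma actE : act = @sigma R m n th. Proof. by rewrite /act -lock. Qed.

Let m_gt0 : (0 < m)%N. Proof. exact: leq_trans m_ge3. Qed.

Lemma point_eq p q : (forall j, ep p j = ep q j) ->
  (forall i, (0 < i <= m)%N -> fi p i = fi q i) ->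
  (forall j, (0 < j <= n)%N -> taui p j = taui q j) -> p = q.
Proof.
case: p q => [[x f] t] [[x' f'] t'] /= hx hf ht; congr (_, _, _).
- exact: (eps_inj hx).
- by apply: vat_inj => i im; apply: (hf i.+1).
- by apply: vat_inj => i im; apply: (ht i.+1).
Qed.

Lemma fi_sigma k p i : (0 < i <= m)%N -> fi (s k p) i =
  if k == 0%N then (fi p i)^-1 else if (k < m)%N then fi p (swp k i)
  else if k == m then sm_f th p i else fi p i.
Proof.
case: i => // i im; rewrite actE.
exact: (vat_row (fun i => if k == 0%N then (fi p i.+1)^-1
  else if (k < m)%N then fi p (swp k i.+1)
  else if k == m then sm_f th p i.+1 else fi p i.+1)).
Qed.

Lemma taui_sigma k p j : (0 < j <= n)%N -> taui (s k p) j =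
  if k == 0%N then (if (j <= m)%N then taui p j * fi p j else taui p j)
  else taui p (swp k j).
Proof.
case: j => // j jn; rewrite actE.
exact: (vat_row (fun j => if k == 0%N then
  (if (j.+1 <= m)%N then taui p j.+1 * fi p j.+1 else taui p j.+1)
  else taui p (swp k j.+1))).
Qed.

Lemma fi_s0 p i : (0 < i <= m)%N -> fi (s 0 p) i = (fi p i)^-1.
Proof. by move=> im; rewrite fi_sigma. Qed.

Lemma fi_slt k p i : (0 < k < m)%N -> (0 < i <= m)%N -> fi (s k p) i = fi p (swp k i).
Proof. by move=> /andP[k0 km] im; rewrite fi_sigma// gtn_eqF// km. Qed.

Lemma fi_sgt k p i : (m < k)%N -> (0 < i <= m)%N -> fi (s k p) i = fi p i.
Proof.
move=> mk im; rewrite fi_sigma// !gtn_eqF ?(leq_ltn_trans _ mk)//.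
by rewrite ltnNge ltnW.
Qed.

Lemma fi_smm p : fi (s m p) m = taui p m / taui p m.+1 * fi p m.
Proof. by rewrite fi_sigma ?m_gt0 ?leqnn// gtn_eqF// ltnn eqxx /sm_f eqxx. Qed.

Lemma fi_sm p i : (0 < i < m)%N -> fi (s m p) i =
  smF th (al p) (ep p m) (ep p m.+1) (ep p i) (taui p m) (taui p m.+1) (fi p i) (fi p m).
Proof.
move=> /andP[i0 im]; rewrite fi_sigma ?i0 ?(ltnW im)// gtn_eqF// ltnn eqxx.
by rewrite /sm_f (ltn_eqF im).
Qed.

Lemma taui_s0l p j : (0 < j <= m)%N -> taui (s 0 p) j = taui p j * fi p j.
Proof.
by move=> /andP[j0 jm]; rewrite taui_sigma ?j0 ?(leq_trans jm (ltnW mn))//= jm.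
Qed.

Lemma taui_s0r p j : (m < j <= n)%N -> taui (s 0 p) j = taui p j.
Proof.
move=> /andP[mj jn]; rewrite taui_sigma ?(leq_ltn_trans _ mj)//= leqNgt mj //.
Qed.

Lemma taui_sS k p j : (0 < k)%N -> (0 < j <= n)%N -> taui (s k p) j = taui p (swp k j).
Proof. by move=> k0 jn; rewrite taui_sigma// gtn_eqF. Qed.

Lemma al_s0 p : al (s 0 p) = - al p.
Proof. by rewrite actE; apply: alpha0_refl0. Qed.

Lemma al_sS k p : (0 < k < n)%N -> k != m -> al (s k p) = al p.
Proof. by rewrite actE => /andP[? ?] ?; apply: alpha0_reflS. Qed.

Lemma al_sm p : al (s m p) = al p + (ep p m - ep p m.+1).
Proof. by rewrite actE; apply: alpha0_reflm. Qed.

Lemma ep_s0l p j : (0 < j <= m)%N -> ep (s 0 p) j = ep p j + al p.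
Proof.
by move=> /andP[j0 jm]; rewrite actE [LHS]eps_refl0// (gtn_eqF j0) jm mul1r.
Qed.

Lemma ep_s0r p j : (m < j)%N -> ep (s 0 p) j = ep p j.
Proof.
move=> mj; rewrite actE [LHS]eps_refl0// gtn_eqF ?(leq_ltn_trans _ mj)//.
by rewrite leqNgt mj mul0r addr0.
Qed.

Lemma ep_s00 p : ep (s 0 p) 0 = ep p 0 + (m%:R - 2) * al p.
Proof. by rewrite actE [LHS]eps_refl0. Qed.

Lemma ep_sS k p j : (0 < k < n)%N -> ep (s k p) j = ep p (swp k j).
Proof. by rewrite actE => /andP[? ?]; apply: eps_reflS. Qed.

(** The last clause is there because [s 0 (s m p)] inverts the f-coordinates of [s m p]. It stops
    before [i = m], where that coordinate is a monomial in nonzero quantities. *)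
Definition good p :=
  [/\ th (al p) != 0, th (al p + (ep p m - ep p m.+1)) != 0 &
      forall i j, (0 < i <= n)%N -> (0 < j <= n)%N -> i != j ->
        th (ep p i - ep p j) != 0] /\
  [/\ forall i, (0 < i <= m)%N -> fi p i != 0,
      forall j, (0 < j <= n)%N -> taui p j != 0 &
      forall i, (0 < i < m)%N -> fi (s m p) i != 0].

(** * The Coxeter relations, coordinate by coordinate *)

Let m0n : (0 < m < n)%N. Proof. by rewrite m_gt0. Qed.

Lemma swp_in k j N : (0 < k < N)%N -> (0 < swp k j <= N)%N = (0 < j <= N)%N.
Proof. by move=> /andP[k0 kN]; rewrite swp_gt0// swp_le. Qed.

Lemma sigmaK0 p : good p -> s 0 (s 0 p) = p.
Proof.
move=> [_ [f0 _ _]]; apply: point_eq => [j|i im|j /andP[j0 jn]].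
- case: (posnP j) => [->|j0]; first by rewrite !ep_s00 al_s0; ring.
  case: (leqP j m) => jm; last by rewrite !ep_s0r.
  by rewrite !ep_s0l ?j0// al_s0 addrK.
- by rewrite !fi_s0// invrK.
- case: (leqP j m) => jm; last by rewrite !taui_s0r ?jm.
  by rewrite !taui_s0l ?fi_s0 ?j0// mulfK// f0// j0.
Qed.

Lemma sigmaKS k p : (0 < k < n)%N -> k != m -> s k (s k p) = p.
Proof.
move=> kn km; have /andP[k0 _] := kn.
apply: point_eq => [j|i im|j jn].
- by rewrite !ep_sS// swpK.
- case: (ltngtP k m) km => // km _; last by rewrite !fi_sgt.
  by rewrite !fi_slt ?swp_in ?k0// swpK.
- by rewrite !taui_sS ?swp_in// swpK.
Qed.

Lemma sigmaKm p : good p -> s m (s m p) = p.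
Proof.
move=> [[a0 a1 e0] [f0 t0 _]].
have mle : (0 < m <= n)%N by rewrite m_gt0 ltnW.
have t1 : taui p m != 0 by exact: t0.
have t2 : taui p m.+1 != 0 by exact: t0.
apply: point_eq => [j|i /andP[i0]|j jn].
- by rewrite !ep_sS// swpK.
- rewrite leq_eqVlt => /predU1P[->|im].
    rewrite !fi_smm !taui_sS// swpL swpR.
    by field; rewrite t1 t2.
  have i0m : (0 < i < m)%N by rewrite i0.
  rewrite !(fi_sm _ i0m) fi_smm al_sm !ep_sS// !taui_sS//.
  rewrite swpL swpR swpD ?ltn_eqF// ?leqW//.
  apply: smF_invol => //; apply: e0; lia.
- by rewrite !taui_sS ?swp_in// swpK.
Qed.

Lemma fi_smE p i : (0 < i <= m)%N -> fi (s m p) i =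
  if i == m then taui p m / taui p m.+1 * fi p m
  else smF th (al p) (ep p m) (ep p m.+1) (ep p i)
         (taui p m) (taui p m.+1) (fi p i) (fi p m).
Proof.
move=> /andP[i0 im]; case: eqVneq => [->|ne]; first exact: fi_smm.
by rewrite fi_sm// i0 ltn_neqAle ne.
Qed.

(** For [k != m] the transposition preserves the blocks 1, ..., m and m+1, ..., n, and s_0 acts by
    the same rule on all indices of a block. *)
Lemma sigma_comm0 k p : (0 < k < n)%N -> k != m -> s 0 (s k p) = s k (s 0 p).
Proof.
move=> kn km; have /andP[k0 kn'] := kn.
have sm j : (swp k j <= m)%N = (j <= m)%N.
  by rewrite /swp; repeat case: eqP => ?; lia.
have smN j : (m < swp k j)%N = (m < j)%N by rewrite !ltnNge sm.
apply: point_eq => [j|i im|j jn].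
- rewrite [RHS]ep_sS//.
  case: (posnP j) => [->|j0].
    by rewrite swpD ?ltn_eqF// !ep_s00 al_sS// ep_sS// swpD ?ltn_eqF.
  have j0' : (0 < swp k j)%N by rewrite swp_gt0.
  case: (leqP j m) => jm.
    have jm' : (swp k j <= m)%N by rewrite sm.
    rewrite ep_s0l ?j0// ep_s0l ?j0'//.
    by rewrite al_sS// ep_sS.
  have jm' : (m < swp k j)%N by rewrite smN.
  by rewrite ep_s0r// ep_s0r// ep_sS.
- case: (ltngtP k m) km => // km _; first last.
    by rewrite fi_s0// !(fi_sgt _ km)// fi_s0.
  have km' : (0 < k < m)%N by rewrite k0.
  by rewrite fi_s0// !(fi_slt _ km')// fi_s0// swp_in.
- have /andP[j0 jn'] := jn.
  have /andP[j0' jn''] : (0 < swp k j <= n)%N by rewrite swp_in.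
  rewrite [RHS]taui_sS//.
  case: (leqP j m) => jm; last first.
    have jm' : (m < swp k j)%N by rewrite smN.
    by rewrite taui_s0r ?jm// taui_s0r ?jm'// taui_sS.
  have jm' : (swp k j <= m)%N by rewrite sm.
  have jm1 : (0 < j <= m)%N by rewrite j0.
  rewrite taui_s0l// taui_s0l ?j0'// taui_sS//; congr (_ * _).
  case: (ltngtP k m) km => // km _; first by rewrite fi_slt ?k0.
  by rewrite fi_sgt// swpD//; lia.
Qed.

Lemma sigma_comm k l p : (0 < k)%N -> (k.+1 < l)%N -> (l < n)%N ->
  s k (s l p) = s l (s k p).
Proof.
move=> k0 kl ln.
have l0 : (0 < l)%N by lia.
have kn : (0 < k < n)%N by lia.
have ln' : (0 < l < n)%N by lia.
apply: point_eq => [j|i im|j jn].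
- by rewrite !(ep_sS _ _ kn, ep_sS _ _ ln') (swp_comm _ kl).
- case: (ltngtP l m) => [lm|ml|lm].
  + have lm' : (0 < l < m)%N by rewrite l0.
    have km : (0 < k < m)%N by lia.
    by rewrite !(fi_slt _ lm', fi_slt _ km) ?swp_in// (swp_comm _ kl).
  + rewrite (fi_sgt _ ml)//; case: (ltngtP k m) => [km|mk|km].
    * have km' : (0 < k < m)%N by rewrite k0.
      by rewrite !(fi_slt _ km')// fi_sgt// swp_in.
    * by rewrite !(fi_sgt _ mk)// fi_sgt.
    (* With [k = m] one has [l >= m + 2], so s_l fixes every index occurring in s_m(f_i). *)
    * have lm : l != m by rewrite gtn_eqF.
      have [e1 e2 e3] : [/\ swp l m = m, swp l m.+1 = m.+1 & swp l i = i].
        by split; apply: swpD; lia.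
      rewrite km !fi_smE// (al_sS _ ln' lm) !(ep_sS _ _ ln').
      rewrite !(taui_sS _ l0); [|lia..].
      by rewrite !(fi_sgt _ ml) ?m_gt0 ?leqnn// e1 e2 e3.
  (* With [l = m], s_k fixes m and m+1 and permutes 1, ..., m-1. The uniform formula [fi_smE] covers
     both [i] and [swp k i], since one equals m exactly when the other does. *)
  + have km : (0 < k < m)%N by lia.
    have km' : k != m by lia.
    have [e1 e2] : [/\ swp k m = m & swp k m.+1 = m.+1].
      by split; apply: swpD; lia.
    rewrite lm [LHS](fi_slt _ km)// !fi_smE ?swp_in// (al_sS _ kn km').
    rewrite !(ep_sS _ _ kn) !(taui_sS _ k0); [|lia..].
    rewrite !(fi_slt _ km) ?m_gt0 ?leqnn// e1 e2.
    by rewrite -{1}e1 (inj_eq (inv_inj (swpK k))).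
- by rewrite !(taui_sS _ k0, taui_sS _ l0) ?swp_in// (swp_comm _ kl).
Qed.

Hypothesis th_riem : riemann_relation th.

(** As s_(m+1) fixes f_i, the right side is s_m(f_i) with eps_(m+2), tau_(m+2) in place of
    eps_(m+1), tau_(m+1). The left side applies the formula twice; for [i < m] the two agree by
    [smF_riemann]. *)
Lemma fi_braid_right p i : good p -> (m.+1 < n)%N -> (0 < i <= m)%N ->
  fi (s m (s m.+1 (s m p))) i = fi (s m.+1 (s m (s m.+1 p))) i.
Proof.
move=> [[a0 a1 e0] [_ t0 _]] m1n /andP[i0 im].
have mS : (0 < m.+1 < n)%N by [].
have mS' : m.+1 != m by rewrite gtn_eqF.
have mm : (0 < m <= m)%N by rewrite m_gt0 leqnn.
have mn' : (0 < m <= n)%N by rewrite m_gt0 ltnW.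
have m1n' : (0 < m.+1 <= n)%N by [].
have m2n' : (0 < m.+2 <= n)%N by [].
have t1 : taui p m.+1 != 0 by exact: t0.
have [em em2] : swp m.+1 m = m /\ swp m m.+2 = m.+2 by split; apply: swpD; lia.
have T q j : (0 < j <= n)%N -> taui (s m q) j = taui q (swp m j) by exact: taui_sS.
have T' q j : (0 < j <= n)%N -> taui (s m.+1 q) j = taui q (swp m.+1 j) by exact: taui_sS.
rewrite (fi_sgt _ (ltnSn m)) ?i0//; move: im; rewrite leq_eqVlt => /predU1P[->|im].
  rewrite !fi_smm (fi_sgt _ (ltnSn m))// fi_smm (fi_sgt _ (ltnSn m))//.
  rewrite !(T', T)// ?em ?swpL ?swpR// ?em ?em2 ?swpL ?swpR//.
  by rewrite mulrA; congr (_ * _); rewrite mulrC mulrA mulfVK.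
have i0m : (0 < i < m)%N by rewrite i0.
have im' : (0 < i <= m)%N by rewrite i0 ltnW.
have [ei ei'] : swp m i = i /\ swp m.+1 i = i by split; apply: swpD; lia.
rewrite !(fi_sm _ i0m) !(fi_sgt _ (ltnSn m))// (fi_sm _ i0m) fi_smm.
rewrite !(al_sS _ mS mS') al_sm !(ep_sS _ _ mS, ep_sS _ _ m0n).
rewrite !(T', T)// ?em ?swpL ?swpR ?ei ?ei'// ?em ?em2 ?swpL ?swpR ?ei ?ei'//.
apply: smF_riemann => //.
- by rewrite pnatr_eq0.
- by apply: e0; lia.
- by apply: e0; lia.
Qed.

(** Here [k = m - 1] exchanges f_(m-1) and f_m, so the indices m-1, m and those below m-1 behave
    differently; they are settled by [smF_chain_last], [smF_swap] and [smF_chain] respectively. *)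
Lemma fi_braid_left k p i : good p -> k.+1 = m -> (0 < i <= m)%N ->
  fi (s k (s m (s k p))) i = fi (s m (s k (s m p))) i.
Proof.
move=> [[a0 a1 e0] [_ t0 _]] km /andP[i0 im].
have k0 : (0 < k)%N by lia.
have kn : (0 < k < n)%N by lia.
have klm : (0 < k < m)%N by lia.
have km' : k != m by lia.
have mm : (0 < m <= m)%N by rewrite m_gt0 leqnn.
have mn' : (0 < m <= n)%N by rewrite m_gt0 ltnW.
have kn' : (0 < k <= n)%N by lia.
have kmle : (0 < k <= m)%N by lia.
have m1n' : (0 < m.+1 <= n)%N by [].
have t1 : taui p m != 0 by exact: t0.
have [em1 ek] : swp k m.+1 = m.+1 /\ swp m k = k by split; apply: swpD; lia.
have [sk sm] : swp k k = m /\ swp k m = k by rewrite -km swpL swpR.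
have T q j : (0 < j <= n)%N -> taui (s m q) j = taui q (swp m j) by exact: taui_sS.
have T' q j : (0 < j <= n)%N -> taui (s k q) j = taui q (swp k j) by exact: taui_sS.
rewrite (fi_slt _ klm) ?i0//.
have S := (swpL m, swpR m, sk, sm, em1, ek).
have [->|ik] := eqVneq i k.
  rewrite sk fi_smm (fi_sm _ klm) !(fi_slt _ klm)// !S fi_smm (fi_sm _ klm).
  rewrite al_sS// al_sm !(ep_sS _ _ kn, ep_sS _ _ m0n) !(T', T)// !S//.
  by apply/esym/smF_chain_last => //; apply: e0; lia.
have [->|im0] := eqVneq i m.
  rewrite sm fi_smm (fi_sm _ klm) !(fi_slt _ klm)// !S (fi_sm _ klm).
  rewrite al_sS// !(ep_sS _ _ kn, ep_sS _ _ m0n) !(T', T)// !S//.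
  by apply/esym/smF_swap => //; apply: e0; lia.
have i0m : (0 < i < m)%N by lia.
have im' : (0 < i <= m)%N by rewrite i0.
have [ei ei'] : swp m i = i /\ swp k i = i by split; apply: swpD; lia.
rewrite ei' !(fi_sm _ i0m) !(fi_slt _ klm)// !(S, ei, ei').
rewrite (fi_sm _ i0m) (fi_sm _ klm).
rewrite !(al_sS _ kn km') al_sm !(ep_sS _ _ kn, ep_sS _ _ m0n) !(T', T)// !(S, ei, ei')//.
by apply/esym/smF_chain => //; apply: e0; lia.
Qed.

Lemma sigma_braid k p : good p -> (0 < k)%N -> (k.+1 < n)%N ->
  s k (s k.+1 (s k p)) = s k.+1 (s k (s k.+1 p)).
Proof.
move=> gp k0 kn1.
have kn : (0 < k < n)%N by lia.
have kn' : (0 < k.+1 < n)%N by [].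
apply: point_eq => [j|i im|j jn].
- by rewrite !(ep_sS _ _ kn, ep_sS _ _ kn') swp_braid.
- case: (ltngtP k m) => [|mk|km].
  + rewrite leq_eqVlt => /predU1P[km|km]; first by rewrite km; apply: fi_braid_left.
    have [km1 km2] : (0 < k < m)%N /\ (0 < k.+1 < m)%N by lia.
    by rewrite !(fi_slt _ km1, fi_slt _ km2) ?swp_in// swp_braid.
  + by rewrite !(fi_sgt _ mk, fi_sgt _ (ltnW mk : m < k.+1)%N).
  + by move: kn1; rewrite km => m1n; apply: fi_braid_right.
- by rewrite !(taui_sS _ k0, taui_sS _ (ltn0Sn k)) ?swp_in// swp_braid.
Qed.

(** Everything rests on s_0 s_m(f_i) = s_m(f_i)/f_i for i < m and s_0 s_m(f_m) = tau_m/tau_(m+1).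
    Both sides then send f_i to f_i/s_m(f_i) for i < m, and tau_j to tau_j s_m(f_j) for j < m. *)
Lemma sigma_braid0 p : good p -> s 0 (s m (s 0 p)) = s m (s 0 (s m p)).
Proof.
move=> [[a0 a1 e0] [f0 t0 g0]].
have mm : (0 < m <= m)%N by rewrite m_gt0 leqnn.
have mn' : (0 < m <= n)%N by rewrite m_gt0 ltnW.
have m1n' : (0 < m.+1 <= n)%N by [].
have tm : taui p m != 0 by exact: t0.
have tm1 : taui p m.+1 != 0 by exact: t0.
have fm : fi p m != 0 by exact: f0.
have T q j : (0 < j <= n)%N -> taui (s m q) j = taui q (swp m j) by exact: taui_sS.
have wu i : (0 < i < m)%N -> th (ep p i - ep p m) != 0 by move=> im; apply: e0; lia.
have wv i : (0 < i < m)%N -> th (ep p i - ep p m.+1) != 0 by move=> im; apply: e0; lia.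
have r0 := ltnSn m.
have r1 : (m < m.+1 <= n)%N by rewrite ltnSn.
have fi0 i : (0 < i < m)%N -> fi p i * fi (s m (s 0 p)) i = fi (s m p) i.
  move=> im; have im' : (0 < i <= m)%N by lia.
  rewrite !(fi_sm _ im) al_s0 (ep_s0l _ mm) (ep_s0l _ im') (ep_s0r _ r0) !fi_s0//.
  rewrite taui_s0l// (taui_s0r _ r1).
  by apply: smF_inv => //; [exact: f0|exact: wu].
have fm0 : fi (s m (s 0 p)) m = taui p m / taui p m.+1.
  by rewrite fi_smm fi_s0// taui_s0l// (taui_s0r _ r1); field; rewrite fm tm1.
have fm1 : fi (s m p) m = taui p m / taui p m.+1 * fi p m by exact: fi_smm.
apply: point_eq => [j|i /andP[i0]|j /andP[j0 jn]].
- rewrite [RHS](ep_sS _ _ m0n).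
  (* This is s_0 s_m(alpha_0) = alpha_m, as for any two joined nodes. *)
  have al2 : al (s m (s 0 p)) = ep p m - ep p m.+1.
    by rewrite al_sm al_s0 (ep_s0l _ mm) (ep_s0r _ r0); ring.
  have [->|jm] := eqVneq j m.
    rewrite swpL (ep_s0r _ r0) (ep_sS _ _ m0n) swpR (ep_s0l _ mm) al2.
    by rewrite (ep_sS _ _ m0n) swpL (ep_s0r _ r0); ring.
  have [->|jm1] := eqVneq j m.+1.
    rewrite swpR (ep_s0r _ r0) (ep_sS _ _ m0n) swpR !(ep_s0l _ mm) al_sm.
    by rewrite (ep_sS _ _ m0n) swpL; ring.
  have sj := swpD jm jm1.
  rewrite sj; have [->|j0] := posnP j.
    have s00 : swp m 0 = 0%N by apply: swpD; lia.
    rewrite !ep_s00 !(ep_sS _ _ m0n) s00 ep_s00 al2 al_sm.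
    by ring.
  have [jlm|mj] := leqP j m.
    have j0m : (0 < j <= m)%N by rewrite j0.
    rewrite !(ep_s0l _ j0m) !(ep_sS _ _ m0n) sj (ep_s0l _ j0m) al2 al_sm.
    by ring.
  by rewrite !(ep_s0r _ mj) !(ep_sS _ _ m0n) sj (ep_s0r _ mj).
- rewrite leq_eqVlt => /predU1P[->|im].
    rewrite fi_s0// fm0 fi_smm fi_s0// fm1 taui_s0l// (taui_s0r _ r1) !T// swpL swpR fm1.
    by field; rewrite fm tm tm1.
  have i0m : (0 < i < m)%N by rewrite i0.
  have im' : (0 < i <= m)%N by lia.
  have si : swp m i = i by apply: swpD; lia.
  have fi1 := fi_sm p i0m.
  have g1 := g0 i i0m.
  rewrite fi_s0//.
  have -> : fi (s m (s 0 p)) i = fi (s m p) i / fi p i.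
    by rewrite -fi0// mulrC mulKf ?f0.
  rewrite [RHS](fi_sm _ i0m) al_s0 al_sm (ep_s0l _ mm) (ep_s0r _ r0) (ep_s0l _ im').
  rewrite !(ep_sS _ _ m0n) !fi_s0// taui_s0l// (taui_s0r _ r1) !T//.
  rewrite al_sm swpL swpR si fm1 invf_div fi1.
  rewrite smF_inv_inv -?fi1//; [exact: wu|exact: wv].
- have [->|jm] := eqVneq j m.
    rewrite taui_s0l// fm0 !T// swpL !(taui_s0r _ r1) T// swpR.
    by field; rewrite tm1.
  have [->|jm1] := eqVneq j m.+1.
    rewrite (taui_s0r _ r1) !T// swpR !taui_s0l// T// swpL fm1.
    by field; rewrite tm1.
  have sj := swpD jm jm1.
  rewrite T ?j0// sj.
  have [jlm|mj] := leqP j m; last by rewrite !taui_s0r ?mj// !T ?j0// sj taui_s0r ?mj.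
  have jm' : (0 < j < m)%N by lia.
  have jm2 : (0 < j <= m)%N by lia.
  by rewrite !taui_s0l// !T ?j0// sj taui_s0l// -mulrA fi0.
Qed.

End Relations.

(** * The good points contain an open dense set *)

Lemma Cplx_arch (R : realType) (x : Cplx R) : exists N : nat, `|x| < N%:R.
Proof.
exists (Num.bound (Normc.normc x)).
rewrite -[X in _ < X](rmorph_nat (real_complex R)) ltcR.
by apply: archi_boundP; case: x => a b /=; exact: sqrtr_ge0.
Qed.

Lemma vat_continuous (K : numFieldType) N j :
  continuous (fun v : 'rV[K]_N => vat v j).
Proof.
rewrite /vat; case: insubP => [k _ _|_]; last by apply: cst_continuous.
exact: coord_continuous.
Qed.

Section Genericity.
Variables (R : realType) (th : Cplx R -> Cplx R) (m n : nat).
Hypotheses (m_ge3 : (3 <= m)%N) (mn : (m < n)%N).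
Hypothesis th_entire : entire th.
Hypothesis th_odd : forall z, th (- z) = - th z.
Hypothesis th_neq0 : exists z, th z != 0.
Hypothesis th_riem : riemann_relation th.
Local Notation C := (Cplx R).
Local Notation point := (Defs.point R m n).
Local Notation al p := (@alpha0 R m n (hx p)).
Local Notation ep p j := (@eps R m n j (hx p)).
Implicit Types p q : point.

Lemma th_continuous : continuous th.
Proof. by move=> z; exact/differentiable_continuous/derivable1_diffP/th_entire. Qed.

Lemma th_nowhere_zero (a r : C) : 0 < r -> exists2 h, `|h| < r & th (a + h) != 0.
Proof.
have [t tn0] := th_neq0.
apply: zero_nowhere_dense tn0 => //; first exact: Cplx_arch.
move=> u un0.
have : nbhs u (th @^-1` [set z | z != 0]).
  apply: th_continuous; rewrite (_ : mkset _ = ~` [set 0]).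
    apply: open_nbhs_nbhs; split; last exact/eqP.
    exact/closed_openC/accessible_closed_set1/hausdorff_accessible/norm_hausdorff.
  by apply/seteqP; split=> z /= /eqP.
move=> /nbhs_ballP[d d0 hd]; exists d => // h hr.
by apply: (hd (u + h)); rewrite -ball_normE /= opprD addrA subrr sub0r normrN.
Qed.

Lemma fi_continuous i : continuous (fun p => fi p i).
Proof.
move=> p; apply: (continuous_comp (f := fun p : point => p.1.2)
  (g := fun v => vat v i.-1)); last exact: vat_continuous.
apply: (continuous_comp (f := fun p : point => p.1) (g := snd)).
  exact: cvg_fst.
exact: cvg_snd.
Qed.

Lemma taui_continuous j : continuous (fun p => taui p j).
Proof.
move=> p; apply: (continuous_comp (f := fun p : point => p.2)
  (g := fun v => vat v j.-1)); last exact: vat_continuous.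
exact: cvg_snd.
Qed.

Lemma ep_continuous j : continuous (fun p => ep p j).
Proof.
move=> p; apply: cvgM; first by apply: cst_continuous.
apply: (continuous_comp (f := fun p : point => p.1.1)
  (g := fun v => vat v j)); last exact: vat_continuous.
apply: (continuous_comp (f := fun p : point => p.1) (g := fst)).
  exact: cvg_fst.
exact: cvg_fst.
Qed.

Lemma al_continuous : continuous (fun p => al p).
Proof.
move=> p; apply: cvgB; first exact: ep_continuous.
elim: (index_iota _ _) => [|i r IH].
  rewrite big_nil; under eq_fun do rewrite big_nil.
  by apply: cst_continuous.
rewrite big_cons; under eq_fun do rewrite big_cons.
apply: (cvgD _ IH); exact: ep_continuous.
Qed.

Lemma th_comp_continuous (g : point -> C) : continuous g ->
  continuous (fun p => th (g p)).
Proof. by move=> cg p; apply: continuous_comp; [exact: cg|exact: th_continuous]. Qed.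

(** Division by [wt i] makes these vectors of h dual to the forms eps_j. *)
Definition dirx i : point := (((wt R m i)^-1 *: \row_(k < n.+1) (val k == i)%:R, 0), 0).
Definition dirf i : point := ((0, \row_(k < m) (val k == i.-1)%:R), 0).
Definition dirt i : point := ((0, 0), \row_(k < n) (val k == i.-1)%:R).

Lemma ep_dirx i p (c : C) j : (i <= n)%N ->
  ep (p + c *: dirx i) j = ep p j + c * (j == i)%:R.
Proof.
move=> jn; rewrite /eps /= vatD !vatZ mulrDr; congr (_ + _).
have [jn1|nj] := ltnP j n.+1; last first.
  by rewrite vat_out// !mulr0 gtn_eqF ?mulr0// (leq_ltn_trans jn).
rewrite (vat_row (fun k => (k == i)%:R))//.
case: eqVneq => [->|_]; last by rewrite !mulr0.
by rewrite !mulr1 mulrCA divff ?mulr1// wt_neq0.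
Qed.

Lemma al_dirx0 p (c : C) : al (p + c *: dirx 0) = al p + c.
Proof.
have E j := ep_dirx p c j (leq0n n).
rewrite /alpha0 E mulr1 addrAC; congr (_ - _ + _).
by apply: eq_big_nat => i /andP[i0 _]; rewrite E gtn_eqF// mulr0 addr0.
Qed.

Lemma fi_dirf i p (c : C) j : (0 < i <= m)%N -> (0 < j <= m)%N ->
  fi (p + c *: dirf i) j = fi p j + c * (j == i)%:R.
Proof.
case: i j => [//|i] [//|j] im jm.
by rewrite /fi /= vatD vatZ (vat_row (fun k => (k == i)%:R)).
Qed.

Lemma taui_dirt i p (c : C) : (0 < i <= n)%N ->
  taui (p + c *: dirt i) i = taui p i + c.
Proof.
case: i => [//|i] im.
by rewrite /taui /= vatD vatZ (vat_row (fun k => (k == i)%:R))// eqxx mulr1.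
Qed.

Lemma hx_dirf i p (c : C) : hx (p + c *: dirf i) = hx p.
Proof. by rewrite /hx /= scaler0 addr0. Qed.

Lemma open_denseT : open_dense [set: point].
Proof. by split=> [|O O0 _]; [exact: openT|rewrite setIT]. Qed.

(** Along [v] the argument [g] sweeps a full disc, and every disc contains a nonzero of [th]. *)
Lemma open_dense_th (g : point -> C) v : continuous g ->
  (forall p c, g (p + c *: v) = g p + c) ->
  open_dense [set p : point | th (g p) != 0].
Proof.
move=> cg gv; apply: (open_dense_neq0 (th_comp_continuous cg) open_denseT) => p _ _.
by exists v => r r0; have [h hr hn] := th_nowhere_zero (g p) r0; exists h; rewrite ?gv.
Qed.

Lemma open_dense_affine (g : point -> C) (D : set point) : continuous g ->
  open_dense D ->
  (forall p, D p -> exists v, exists2 b : C,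
     b != 0 & forall c, g (p + c *: v) = g p + c * b) ->
  open_dense [set p : point | g p != 0].
Proof.
move=> cg oD gv; apply: (open_dense_neq0 cg oD) => p Dp gp.
have [v [b b0 hv]] := gv p Dp.
(* At a zero of [g] its value after a step [c] is [c * b], so any nonzero step shorter than [r]
   serves. *)
exists v => r r0; exists (r / 2%:R).
  rewrite ger0_norm ?divr_ge0 ?ltW// ltr_pdivrMr ?ltr0n//.
  by rewrite mulr_natr mulr2n ltrDl.
by rewrite hv gp add0r !mulf_neq0 ?invr_eq0 ?pnatr_eq0// gt_eqF.
Qed.

Lemma open_dense_imp (b : bool) (D : set point) : (b -> open_dense D) ->
  open_dense [set p : point | b -> D p].
Proof.
case: b => [h|_].
  rewrite (_ : mkset _ = D); first exact: h.
  by apply/seteqP; split=> p /=; [apply|].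
rewrite (_ : mkset _ = setT); first exact: open_denseT.
by apply/seteqP; split.
Qed.

Lemma open_dense_nat N (P : nat -> set point) :
  (forall i, (0 < i <= N)%N -> open_dense (P i)) ->
  open_dense [set p : point | forall i, (0 < i <= N)%N -> P i p].
Proof.
move=> h; rewrite (_ : mkset _ = [set p : point | forall i : 'I_N, P i.+1 p]).
  by apply: open_dense_all => i; apply: h; rewrite ltn_ord.
apply/seteqP; split=> p /= hp i; first by apply: hp; rewrite ltn_ord.
by case: i => // i iN; exact: (hp (Ordinal iN)).
Qed.

Lemma open_dense_al : open_dense [set p : point | th (al p) != 0].
Proof. exact: open_dense_th al_continuous (al_dirx0). Qed.

Lemma open_dense_alm :
  open_dense [set p : point | th (al p + (ep p m - ep p m.+1)) != 0].
Proof.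
(* The direction [dirx 0] moves eps_0, hence alpha_0, and leaves eps_m and eps_(m+1) fixed. *)
apply: (@open_dense_th (fun p : point => al p + (ep p m - ep p m.+1)) (dirx 0)).
  move=> p; apply: cvgD; first exact: al_continuous.
  by apply: cvgB; exact: ep_continuous.
move=> p c; have E j := ep_dirx p c j (leq0n n).
have m0 : (m == 0%N) = false by lia.
by rewrite al_dirx0 !E m0 !mulr0 !addr0 addrAC.
Qed.

Lemma open_dense_ep i j : (0 < i <= n)%N -> i != j ->
  open_dense [set p : point | th (ep p i - ep p j) != 0].
Proof.
move=> /andP[i0 iN] ij.
apply: (@open_dense_th (fun p : point => ep p i - ep p j) (dirx i)).
  by move=> p; apply: cvgB; exact: ep_continuous.
move=> p c; have E k := ep_dirx p c k iN.
by rewrite !E eqxx (eq_sym j) (negbTE ij) mulr0 addr0 mulr1 addrAC.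
Qed.

Lemma open_dense_fi i : (0 < i <= m)%N -> open_dense [set p : point | fi p i != 0].
Proof.
move=> im; apply: (open_dense_affine (@fi_continuous i) open_denseT) => p _.
exists (dirf i), 1 => [|c]; first exact: oner_neq0.
by rewrite fi_dirf// eqxx.
Qed.

Lemma open_dense_taui j : (0 < j <= n)%N -> open_dense [set p : point | taui p j != 0].
Proof.
move=> jn; apply: (open_dense_affine (@taui_continuous j) open_denseT) => p _.
exists (dirt j), 1 => [|c]; first exact: oner_neq0.
by rewrite taui_dirt// mulr1.
Qed.

Definition num_sm p i :=
  th (al p + (ep p m - ep p m.+1)) * th (ep p i - ep p m.+1) * fi p i
  - th (al p + (ep p i - ep p m.+1)) * th (ep p m - ep p m.+1) * fi p m.

Lemma num_sm_continuous i : continuous (fun p => num_sm p i).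
Proof.
have A k l : continuous (fun p => th (ep p k - ep p l)).
  by apply: th_comp_continuous => p; apply: cvgB; exact: ep_continuous.
have B k l : continuous (fun p => th (al p + (ep p k - ep p l))).
  apply: th_comp_continuous => p; apply: cvgD; first exact: al_continuous.
  by apply: cvgB; exact: ep_continuous.
move=> p; apply: cvgB; (apply: cvgM; [apply: cvgM|exact: fi_continuous]).
- exact: B.
- exact: A.
- exact: B.
- exact: A.
Qed.

(** The numerator is affine in f_i, with slope a product of two theta values that is nonzero on an
    open dense set. *)
Lemma open_dense_num_sm i : (0 < i < m)%N -> open_dense [set p : point | num_sm p i != 0].
Proof.
move=> im; apply: (open_dense_affine (@num_sm_continuous i)
  (open_denseI open_dense_alm (@open_dense_ep i m.+1 _ _))); [lia|lia|].
move=> p [h1 h2].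
exists (dirf i), (th (al p + (ep p m - ep p m.+1)) * th (ep p i - ep p m.+1)).
  exact: mulf_neq0.
have iM : (0 < i <= m)%N by lia.
have mM : (0 < m <= m)%N by lia.
have mi : (m == i) = false by lia.
move=> c; rewrite /num_sm hx_dirf (fi_dirf p c iM iM) (fi_dirf p c iM mM).
by rewrite eqxx mi mulr1 mulr0 addr0; ring.
Qed.

Lemma good_generic : exists2 G, open_dense G & forall p, G p -> good th p.
Proof.
pose G1 := [set p : point | th (al p) != 0]
  `&` [set p : point | th (al p + (ep p m - ep p m.+1)) != 0].
pose G2 := [set p : point | forall i, (0 < i <= n)%N -> forall j, (0 < j <= n)%N ->
   i != j -> th (ep p i - ep p j) != 0].
pose G3 := [set p : point | forall i, (0 < i <= m)%N -> fi p i != 0].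
pose G4 := [set p : point | forall i, (0 < i <= n)%N -> taui p i != 0].
(* The numerator, continuous everywhere, stands in for the quotient s_m(f_i); the other sets make
   the remaining factors nonzero. *)
pose G5 := [set p : point | forall i, (0 < i <= m)%N -> (i < m)%N -> num_sm p i != 0].
exists (G1 `&` G2 `&` (G3 `&` G4 `&` G5)).
  apply: open_denseI; apply: open_denseI.
  - exact: open_denseI open_dense_al open_dense_alm.
  - apply: (@open_dense_nat n (fun i => [set p : point | forall j, (0 < j <= n)%N ->
      i != j -> th (ep p i - ep p j) != 0])) => i iN.
    apply: (@open_dense_nat n (fun j =>
      [set p : point | i != j -> th (ep p i - ep p j) != 0])) => j jN.
    by apply: open_dense_imp => ij; exact: open_dense_ep.
  - apply: open_denseI.
      exact: (@open_dense_nat m (fun i => [set p : point | fi p i != 0])) open_dense_fi.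
    exact: (@open_dense_nat n (fun i => [set p : point | taui p i != 0])) open_dense_taui.
  - apply: (@open_dense_nat m (fun i =>
      [set p : point | (i < m)%N -> num_sm p i != 0])) => i im.
    by apply: open_dense_imp => ij; apply: open_dense_num_sm; lia.
move=> p [[[a0 a1] e0] [[f0 t0] g0]]; split; split => //.
  by move=> i j iN jN; apply: e0.
move=> i im.
have e1 : th (ep p i - ep p m) != 0 by apply: e0; lia.
have t1 : taui p m != 0 by apply: t0; lia.
have t2 : taui p m.+1 != 0 by apply: t0; lia.
have gi : num_sm p i != 0 by apply: g0; lia.
by rewrite fi_sm// /smF !mulf_neq0 ?invr_eq0 ?mulf_neq0.
Qed.

End Genericity.

(** Because (s_k F)(p) = F(sigma_k p), words in the s_k become compositions of the sigma_k in
    reverse order. Reversal at most exchanges the two sides of a relation, so the relations may be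
    checked on points. *)
Theorem theorem3 (R : realType) (th : Cplx R -> Cplx R) (m n : nat)
    (Hm : (3 <= m)%N) (Hmn : (m < n)%N)
    (Hhol : entire th)
    (Hodd : forall z, th (- z) = - th z)
    (Hnz : exists z, th z != 0)
    (Hriem : riemann_relation th) :
  (forall i : 'I_n,
     generically_eq (@sigma R m n th i \o @sigma R m n th i) id) /\
  (forall i j : 'I_n, i != j -> ~~ joined m i j ->
     generically_eq (@sigma R m n th i \o @sigma R m n th j)
                    (@sigma R m n th j \o @sigma R m n th i)) /\
  (forall i j : 'I_n, joined m i j ->
     generically_eq (@sigma R m n th i \o @sigma R m n th j \o @sigma R m n th i)
                    (@sigma R m n th j \o @sigma R m n th i \o @sigma R m n th j)).
Proof.
have [G [oG dG] gG] := good_generic Hm Hmn Hhol Hodd Hnz Hriem.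
rewrite -!actE.
split; [move=> i|split=> i j].
- exists G; do 2!split=> //; move=> p /gG gp /=.
  have iN := ltn_ord i.
  have [i0|i0] := posnP i; first by rewrite i0; apply: sigmaK0.
  have [im|im] := eqVneq (val i) m; first by rewrite im; apply: sigmaKm.
  by apply: sigmaKS => //; rewrite i0.
- move=> ij nij; exists G; do 2!split=> //; move=> p _ /=.
  have iN := ltn_ord i; have jN := ltn_ord j.
  move: ij nij; rewrite -val_eqE /joined /=.
  move: (val i) (val j) iN jN => {}i {}j iN jN ij nij.
  wlog lij : i j iN jN ij nij / (i < j)%N => [W|].
    by case: (ltngtP i j) (ij) => // lij _; [|apply/esym]; apply: W => //; lia.
  have [i0|i0] := posnP i; last by apply: sigma_comm => //; lia.
  by rewrite i0; apply: sigma_comm0 => //; lia.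
- move=> jij; exists G; do 2!split=> //; move=> p /gG gp /=.
  have iN := ltn_ord i; have jN := ltn_ord j.
  move: jij; rewrite /joined.
  move: (val i) (val j) iN jN => {}i {}j iN jN jij.
  wlog lij : i j iN jN jij / (i < j)%N => [W|].
    by case: (ltngtP i j) => lij; [|apply/esym|]; [apply: W|apply: W|]; lia.
  have [i0|i0] := posnP i.
    have -> : j = m by lia.
    by rewrite i0; apply: sigma_braid0.
  have ej : j = i.+1 by lia.
  by rewrite ej; apply: sigma_braid => //; rewrite -ej.
Qed.
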